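(* Let $X,T_1,T_2\in\mathcal{B}(\mathcal{H})$ be contractions such that $T_1X=XT_2$. Let $V\in\mathcal{B}(\mathcal{K})$, $\mathcal{K}\supseteq\mathcal{H}$, be an isometric lift of $X$. Then there is a contractive lift $S_1\in\mathcal{B}(\mathcal{K})$ of $T_1$ and a norm preserving lift $S_2\in\mathcal{B}(\mathcal{K})$ of $T_2$ such that $S_1V=VS_2$.
   Context: All Hilbert spaces are complex; $\mathcal{B}(\mathcal{H})$ is the algebra of bounded linear operators on $\mathcal{H}$; containment of Hilbert spaces means containment as a closed linear subspace; a contraction is an operator of norm at most one. An operator $B\in\mathcal{B}(\mathcal{K})$ is a lift of $A\in\mathcal{B}(\mathcal{H})$, $\mathcal{H}\subseteq\mathcal{K}$, if $\mathcal{H}$ is invariant under $B^*$ and $B^*|_{\mathcal{H}}=A^*$. It is an isometric (resp. contractive) lift if in addition $B$ is an isometry (resp. a contraction), and a norm preserving lift if in addition $\|B\|=\|A\|$. *)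

(* Defs.v *)
From HB Require Import structures.
From mathcomp Require Import all_boot all_order all_algebra sesquilinear.
From mathcomp Require Import complex.
From mathcomp Require Import all_classical all_reals all_analysis.
From mathcomp Require Import ring lra.

Set Implicit Arguments.
Unset Strict Implicit.
Unset Printing Implicit Defensive.
Import Order.TTheory GRing.Theory Num.Theory.
Import numFieldNormedType.Exports.
Local Open Scope classical_set_scope.
Local Open Scope ring_scope.
Local Open Scope complex_scope.

(* Hilbert spaces over the complex field R[i], R any realType; the inner product
   is linear in its first argument and conjugate-linear in the second. *)
HB.mixin Record NormedModule_isInnerProduct (R : realType) H
    & NormedModule R[i] H := {
  inner : {dot H for (@Num.conj R[i])} ;
  normr_inner : forall x : H, `|x| ^+ 2 = inner x x
}.

#[short(type="hilbertType")]
HB.structure Definition Hilbert (R : realType) :=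
  {H of CompleteNormedModule R[i] H & NormedModule_isInnerProduct R H}.

Section RealNorm.
Context {R : realType} {H : hilbertType R}.
Implicit Types x y : H.

(* The library norm takes values in R[i]; rnorm is the same number in R. *)
Definition rnorm x : R := complex.Re `|x|.

Lemma rnormE x : `|x| = (rnorm x)%:C.
Proof. by rewrite /rnorm RRe_real// normr_real. Qed.

Definition ip x y : R := complex.Re (inner x y).

Lemma rnorm_ip x : rnorm x ^+ 2 = ip x x.
Proof. by rewrite /ip -normr_inner rnormE -rmorphXn. Qed.

Lemma rnorm_ge0 x : 0 <= rnorm x.
Proof. by rewrite -ler0c -rnormE. Qed.
Lemma ipC x y : ip x y = ip y x.
Proof. by rewrite /ip hermC /= expr0 mul1r; case: (inner y x). Qed.
Lemma ipDl x y z : ip (x + y) z = ip x z + ip y z.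
Proof. by rewrite /ip linearDl raddfD. Qed.
Lemma ipZl (a : R) x z : ip (a%:C *: x) z = a * ip x z.
Proof. by rewrite /ip linearZl_LR /=; case: (inner x z) => u v /=; rewrite mul0r subr0. Qed.
Lemma ipDr x y z : ip z (x + y) = ip z x + ip z y.
Proof. by rewrite !(ipC z) ipDl. Qed.
Lemma ipZr (a : R) x z : ip z (a%:C *: x) = a * ip z x.
Proof. by rewrite !(ipC z) ipZl. Qed.

Lemma ipNl x y : ip (- x) y = - ip x y.
Proof. by rewrite /ip linearNl raddfN. Qed.

Lemma rnormN x : rnorm (- x) = rnorm x.
Proof. by rewrite /rnorm normrN. Qed.

Lemma rnormD2 x y : rnorm (x + y) ^+ 2 = rnorm x ^+ 2 + rnorm y ^+ 2 + 2 * ip x y.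
Proof. rewrite !rnorm_ip !(ipDl, ipDr) (ipC y x); ring. Qed.

Lemma rnormZr2 (a : R) x : rnorm (a%:C *: x) ^+ 2 = a ^+ 2 * rnorm x ^+ 2.
Proof. rewrite !rnorm_ip ipZl ipZr; ring. Qed.

Lemma rnorm_eq0 x : (rnorm x == 0) = (x == 0).
Proof. by rewrite -(normr_eq0 x) rnormE (eq_complex _ 0) /= eqxx andbT. Qed.

Lemma ip_le x y : ip x y <= rnorm x * rnorm y.
Proof.
have [->|x0] := eqVneq x 0.
  by rewrite /ip linear0l /= mulr_ge0 ?rnorm_ge0.
have [->|y0] := eqVneq y 0.
  by rewrite /ip linear0r /= mulr_ge0 ?rnorm_ge0.
have xp : 0 < rnorm x by rewrite lt_neqAle eq_sym rnorm_eq0 x0 rnorm_ge0.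
have yp : 0 < rnorm y by rewrite lt_neqAle eq_sym rnorm_eq0 y0 rnorm_ge0.
have := sqr_ge0 (rnorm ((rnorm y)%:C *: x + (- rnorm x)%:C *: y)).
rewrite rnormD2 !rnormZr2 ipZl ipZr.
have -> : rnorm y ^+ 2 * rnorm x ^+ 2 + (- rnorm x) ^+ 2 * rnorm y ^+ 2 +
  2 * (rnorm y * (- rnorm x * ip x y)) =
  2 * (rnorm x * rnorm y) * (rnorm x * rnorm y - ip x y) by ring.
by rewrite pmulr_rge0 ?subr_ge0// !mulr_gt0.
Qed.

Lemma inner_ext x y : (forall h, inner h x = inner h y) -> x = y.
Proof.
move=> E; apply/eqP; rewrite -subr_eq0 -rnorm_eq0 -sqrf_eq0 rnorm_ip /ip.
rewrite linearBr /= E.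
by rewrite subrr.
Qed.

(* A decreasing family of nonempty sets of vanishing diameters converges. *)
Lemma cauchy_family (D : R -> set H) :
    (forall e e', e <= e' -> D e `<=` D e') ->
    (forall e, 0 < e -> D e !=set0) ->
    (forall e, 0 < e -> exists2 d, 0 < d &
      forall x y, D d x -> D d y -> rnorm (x - y) < e) ->
  exists z, forall e, 0 < e -> exists2 x, D e x & rnorm (z - x) < e.
Proof.
move=> mD D0 cD.
pose F : set_system H := [set A | exists2 d, 0 < d & D d `<=` A].
have FF : ProperFilter F.
  apply: Build_ProperFilter_ex => [A [d d0 dA]|].
    by have [x Dx] := D0 d d0; exists x; exact: dA.
  split=> [|A B [d d0 dA] [e e0 eB]|A B AB [d d0 dA]].
  - by exists 1.
  - exists (Num.min d e); first by rewrite lt_min d0 e0.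
    move=> x Dx; split; [apply: dA|apply: eB]; move: Dx; apply: mD;
      by rewrite ge_min lexx ?orbT.
  - by exists d => //; exact: subset_trans AB.
have epsR (eps : R[i]) : 0 < eps -> eps = (complex.Re eps)%:C /\ 0 < complex.Re eps.
  by move=> e0; have E := RRe_real (gtr0_real e0); rewrite E -ltcR E.
have : cvg F.
  apply: cauchy_cvg; apply: cauchy_exP => eps /epsR[-> e0].
  have [d d0 Dd] := cD _ e0; have [x Dx] := D0 _ d0.
  exists x, d => // y Dy; rewrite -ball_normE /= rnormE ltcR.
  exact: Dd.
move=> /cvg_ex[z Fz]; exists z => e e0.
have [d d0 dz] : F (ball z e%:C) by apply: Fz; apply: nbhsx_ballx; rewrite ltcR.
have m0 : 0 < Num.min d e by rewrite lt_min d0 e0.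
have [x Dx] := D0 _ m0; exists x.
  by move: Dx; apply: mD; rewrite ge_min lexx orbT.
have : ball z e%:C x by apply: dz; move: Dx; apply: mD; rewrite ge_min lexx.
by rewrite -ball_normE /= rnormE ltcR.
Qed.

End RealNorm.

(* The algebra B(H). *)
Record bop (R : realType) (H : hilbertType R) := Bop {
  bop_fun :> {linear H -> H} ;
  bop_bounded : bounded_near bop_fun (nbhs (0 : H))
}.

Section Operators.
Context {R : realType} {H : hilbertType R}.
Implicit Types (A : bop H) (x y z : H).

Definition opnorm A : R := sup [set rnorm (A x) | x in [set x | `|x| <= 1]].

Definition contractive A : Prop := opnorm A <= 1.

Definition isometric A := forall x, `|A x| = `|x|.

Lemma bop_le A : exists2 M : R, 0 <= M & forall x, rnorm (A x) <= M * rnorm x.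
Proof.
have /linear_boundedP/pinfty_ex_gt0[r r0 Ar] := bop_bounded A.
have E := RRe_real (gtr0_real r0).
exists (complex.Re r); first by rewrite -lecR E ltW.
by move=> x; rewrite -lecR rmorphM /= E -!rnormE.
Qed.

Lemma bop_intro (f : {linear H -> H}) (M : R) :
  (forall x, rnorm (f x) <= M * rnorm x) -> bounded_near f (nbhs (0 : H)).
Proof.
move=> fM; apply/linear_boundedP; near=> r => x.
rewrite (@le_trans _ _ (M%:C * `|x|))//.
  by rewrite !rnormE -rmorphM lecR.
rewrite ler_wpM2r//; near: r; apply: nbhs_pinfty_ge.
by rewrite complex_real.
Unshelve. all: by end_near. Qed.

Lemma opnorm_has_sup A :
  has_sup [set rnorm (A x) | x in [set x | `|x| <= 1]].
Proof.
split; first by exists (rnorm (A 0)), 0 => //=; rewrite normr0 ler01.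
have [M M0 AM] := bop_le A; exists M => _ [x /= + <-].
rewrite rnormE (lecR _ 1) => x1.
by rewrite (le_trans (AM x))// ler_piMr.
Qed.

Lemma opnorm_le A x : rnorm (A x) <= opnorm A * rnorm x.
Proof.
have [->|x0] := eqVneq x 0; first by rewrite linear0 /rnorm normr0 mulr0.
have xp : 0 < rnorm x by rewrite lt_neqAle eq_sym rnorm_eq0 x0 rnorm_ge0.
rewrite -ler_pdivrMr//; apply: ub_le_sup; first exact: (opnorm_has_sup A).2.
have rZ (a : R) y : 0 <= a -> rnorm (a%:C *: y) = a * rnorm y.
  move=> a0; apply/eqP; rewrite -(@eqrXn2 _ 2) ?mulr_ge0 ?rnorm_ge0//.
  by rewrite rnormZr2 exprMn.
have v0 : 0 <= (rnorm x)^-1 by rewrite invr_ge0 rnorm_ge0.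
exists ((rnorm x)^-1%:C *: x); first by rewrite /= rnormE (lecR _ 1) rZ// mulVf// gt_eqF.
by rewrite linearZ /= rZ// mulrC.
Qed.

(* Riesz representation, by minimising |z|^2 - 2 Re (f z). *)
Lemma riesz (f : {linear H -> R[i] | *%R}) (M : R) :
    (forall x, complex.Re (f x) <= M * rnorm x) ->
  exists z, forall x, f x = inner x z.
Proof.
move=> fM; pose g x := complex.Re (f x).
have gD x y : g (x + y) = g x + g y by rewrite /g linearD raddfD.
have gZ (a : R) x : g (a%:C *: x) = a * g x.
  by rewrite /g linearZ /=; case: (f x) => u v /=; rewrite mul0r subr0.
pose J x := rnorm x ^+ 2 - 2 * g x.
pose S := range J; pose m := inf S.
have Jlb : has_inf S.
  split; first by exists (J 0), 0.
  exists (- M ^+ 2) => _ [x _ <-]; rewrite /J.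
  have := fM x; rewrite -/(g x) => gx; have := sqr_ge0 (rnorm x - M); nra.
have mJ x : m <= J x by apply: ge_inf; [exact: Jlb.2|exists x].
have JD x h (t : R) : J (x + t%:C *: h) =
    J x + 2 * t * (ip h x - g h) + t ^+ 2 * rnorm h ^+ 2.
  by rewrite /J rnormD2 rnormZr2 gD gZ ipZr (ipC h); ring.
have [z Dz] : exists z, forall e, 0 < e ->
    exists2 x, J x < m + e & rnorm (z - x) < e.
  apply: (@cauchy_family _ _ (fun e => [set x | J x < m + e])).
  - by move=> e e' ee x /= /lt_le_trans; apply; rewrite lerD2l.
  - move=> e e0; have [_ [x _ <-] Jx] := inf_adherent e0 Jlb.
    by exists x.
  - move=> e e0; exists (e ^+ 2 / 4); first by rewrite divr_gt0 ?exprn_gt0.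
    move=> x y /= Jx Jy; rewrite -(@ltr_pXn2r _ 2) ?nnegrE ?rnorm_ge0 ?ltW//.
    have := mJ (x + (2^-1)%:C *: (y - x)).
    have Jy' := JD x (y - x) 1; rewrite scale1r (addrC x) subrK in Jy'.
    rewrite JD -(rnormN (x - y)) opprB; move: Jy' Jx Jy => ->.
    move: (ip _ _) (g _) (J x) (rnorm _ ^+ 2) => a b c d; lra.
have key x : ip x z = g x.
  apply/eqP; rewrite -subr_eq0 -normr_eq0; apply/eqP.
  set d := ip x z - g x.
  have min (t : R) : 0 <= 2 * t * d + t ^+ 2 * rnorm x ^+ 2.
    apply/ler_addgt0Pr => e e0.
    have c0 : 0 < 1 + 2 * `|t| * rnorm x.
      by rewrite ltr_pwDl ?mulr_ge0 ?rnorm_ge0.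
    have [w Jw zw] := Dz (e / (1 + 2 * `|t| * rnorm x)) (divr_gt0 e0 c0).
    move: zw Jw; set k := e / _ => zw Jw.
    have ek : e = k + 2 * (`|t| * (rnorm x * k)).
      rewrite -[e in LHS](divfK (lt0r_neq0 c0)) -/k; ring.
    have := mJ (w + t%:C *: x); rewrite JD => mw.
    have I : t * ip x w - t * ip x z <= `|t| * (rnorm x * k).
      have -> : t * ip x w - t * ip x z = ip (t%:C *: x) (w - z).
        by rewrite ipZl ipDr [ip x (- z)]ipC ipNl (ipC z); ring.
      rewrite (le_trans (ip_le _ _))//.
      have -> : rnorm (t%:C *: x) = `|t| * rnorm x.
        apply/eqP; rewrite -(@eqrXn2 _ 2) ?mulr_ge0 ?rnorm_ge0//.
        by rewrite rnormZr2 exprMn real_normK ?num_real.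
      rewrite -mulrA ler_wpM2l// ler_wpM2l ?rnorm_ge0//.
      by rewrite -rnormN opprB ltW.
    move: ek mw I; rewrite /d; move: (`|t| * (_ * _)) => q; lra.
  have N0 : 0 < 1 + rnorm x ^+ 2 by rewrite ltr_pwDl ?sqr_ge0.
  have := min (- d / (1 + rnorm x ^+ 2)).
  set n := rnorm x ^+ 2 in N0 *; set t := - d / _.
  have dt : d = - t * (1 + n) by rewrite /t !mulNr opprK divfK ?lt0r_neq0.
  rewrite {1}dt => h.
  have n0 : 0 <= n by exact: sqr_ge0.
  have t0 : t ^+ 2 <= 0 by have := sqr_ge0 t; nra.
  have : t = 0 by apply/eqP; rewrite -sqrf_eq0 eq_le t0 sqr_ge0.
  by rewrite dt => ->; rewrite oppr0 mul0r normr0.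
have ReIm (a b : R[i]) : complex.Re a = complex.Re b ->
    complex.Re ('i * a) = complex.Re ('i * b) -> a = b.
  by case: a b => [a1 a2] [b1 b2] /= -> ; rewrite !mul0r !mul1r => /subrI ->.
exists z => x; apply: ReIm; first by rewrite -[LHS]/(g x) -key.
rewrite -[X in complex.Re X = _]linearZ_LR -linearZl_LR -[LHS]/(g _).
by rewrite -key.
Qed.

Lemma adj_exists A :
  exists B : bop H, forall x y, inner (A x) y = inner x (B y).
Proof.
have [M M0 AM] := bop_le A.
have /choice[B AB] : forall y, exists z, forall x, inner (A x) y = inner x z.
  move=> y.
  have lf : linear_for *%R (fun x => inner (A x) y).
    by move=> a u v; rewrite linearP linearPl.
  pose F := GRing.isLinear.Build _ _ _ _ _ lf.
  pose f : {linear H -> R[i] | *%R} := HB.pack (fun x => inner (A x) y) F.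
  apply: (@riesz f (M * rnorm y)) => x /=.
  rewrite (le_trans (ip_le _ _))//.
  by rewrite mulrAC ler_wpM2r ?rnorm_ge0.
have lB : linear B.
  move=> a u v; apply: inner_ext => h.
  by rewrite -AB !linearPr /= !AB.
pose F := GRing.isLinear.Build _ _ _ _ _ lB.
pose f : {linear H -> H} := HB.pack B F.
have fb x : rnorm (f x) <= M * rnorm x.
  have [->|f0] := eqVneq (rnorm (f x)) 0; first by rewrite mulr_ge0 ?rnorm_ge0.
  have fp : 0 < rnorm (f x) by rewrite lt_neqAle eq_sym f0 rnorm_ge0.
  rewrite -(ler_pM2l fp) -expr2 rnorm_ip /ip -AB (le_trans (ip_le _ _))//.
  by rewrite mulrA ler_wpM2r ?rnorm_ge0// mulrC.
by exists (Bop (bop_intro fb)).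
Qed.

(* The Hilbert space adjoint, unique by inner_ext. *)
Definition adj A : bop H := projT1 (cid (adj_exists A)).

Lemma adjP A x y : inner (A x) y = inner x (adj A y).
Proof. exact: (projT2 (cid (adj_exists A))). Qed.

End Operators.

(* A containment of Hilbert spaces H <= K, given by its inclusion map. Since H
   is complete, its image is automatically a closed subspace (incl_closed). *)
Record inclusion (R : realType) (H K : hilbertType R) := Inclusion {
  incl :> {linear H -> K} ;
  incl_inner : forall x y, inner (incl x) (incl y) = inner x y
}.

Section Lifts.
Context {R : realType} {H K : hilbertType R} (j : inclusion H K).

Lemma incl_closed : closed (range j).
Proof.
have jn x : rnorm (j x) = rnorm x.
  apply/eqP; rewrite -(@eqrXn2 _ 2) ?rnorm_ge0//.
  by rewrite !rnorm_ip /ip incl_inner.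
have tri (x y z : K) : rnorm (x - y) <= rnorm (z - x) + rnorm (z - y).
  rewrite -lecR rmorphD /= -!rnormE (distrC z) -(subrKA z x (- y)).
  exact: ler_normD.
move=> y cy.
have D0 (e : R) : 0 < e -> exists h, rnorm (y - j h) < e.
  move=> e0; have [_ [[h _ <-]]] : range j `&` ball y e%:C !=set0.
    by apply: cy; apply: nbhsx_ballx; rewrite ltcR.
  by rewrite -ball_normE /= rnormE ltcR; exists h.
have [z zP] : exists z, forall e, 0 < e ->
    exists2 h, rnorm (y - j h) < e & rnorm (z - h) < e.
  apply: (@cauchy_family _ _ (fun e => [set h | rnorm (y - j h) < e])).
  - by move=> e e' ee h /= /lt_le_trans; exact.
  - by move=> e /D0[h]; exists h.
  - move=> e e0; exists (e / 2); first by rewrite divr_gt0.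
    move=> h k /= hh kk; rewrite -jn linearB /= (le_lt_trans (tri _ _ y))//.
    by rewrite [ltRHS](splitr e) ltrD.
exists z => //; apply/eqP; rewrite -subr_eq0 -rnorm_eq0 eq_le rnorm_ge0 andbT.
apply/ler_addgt0Pr => e e0; rewrite add0r.
have [h yh zh] := zP (e / 2) (divr_gt0 e0 (ltr0Sn _ 1)).
rewrite (le_trans (tri _ _ (j h)))// [leRHS](splitr e) lerD//.
  by rewrite -linearB jn -rnormN opprB ltW.
by rewrite -rnormN opprB ltW.
Qed.

(* With H seen in K through j: B^* leaves H invariant and restricts to A^* on H. *)
Definition is_lift (A : bop H) (B : bop K) :=
  forall h, adj B (j h) = j (adj A h).

Definition isometric_lift A B := is_lift A B /\ isometric B.

Definition contractive_lift A B := is_lift A B /\ contractive B.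

Definition norm_preserving_lift A B := is_lift A B /\ opnorm B = opnorm A.

End Lifts.

(* Main.v *)
Require Import Defs.
From mathcomp Require Import all_boot all_order all_algebra all_reals.
From HB Require Import structures.
From mathcomp Require Import sesquilinear complex all_classical all_analysis.
From mathcomp Require Import ring lra.

Set Implicit Arguments.
Unset Strict Implicit.
Unset Printing Implicit Defensive.
Import Order.TTheory GRing.Theory Num.Theory.
Import numFieldNormedType.Exports.
Local Open Scope classical_set_scope.
Local Open Scope ring_scope.
Local Open Scope complex_scope.

(** Write [P = j j^*] for the orthogonal projection of [K] onto the image of [H].
That [B] lifts [A] means [j^* B = A j^*] ([is_liftP]). The operator
[S2 := j T2 j^*] is therefore a lift of [T2] with the same norm, and it remains
to find a contraction [S1] satisfying
  - [S1 V = V S2], which prescribes [S1] on the range of [V];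
  - [j^* S1 = T1 j^*], which prescribes the component of [S1] along [H].
Both prescribed parts are contractions, the first because [V] is isometric, and
they agree where they overlap:
[j^* (V S2) = X j^* S2 = X T2 j^* = T1 X j^* = (T1 j^* ) V].
Parrott's theorem ([parrott]) then provides [S1].

In Parrott's theorem one has a contraction [C : E -> H] and a linear map defined
on a subspace [a(U)] of [E] by [a u |-> b u], and looks for [S = j C + (1 - P) Q].
By Pythagoras, [S] is a contraction as soon as
[|Q x|^2 <= |x|^2 - |C x|^2], and the map [a u |-> (1 - P) (b u)] already satisfies
this on [a(U)]. So [Q] must extend this map without increasing its norm with
respect to the defect seminorm [dnorm C x = sqrt (|x|^2 - |C x|^2)], and
composing with the orthogonal projection for that seminorm does it
([column_completion]). As [E] need not be complete for this seminorm, the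
projection of [x] is replaced by elements [a u] for which [x - a u] is nearly
orthogonal to [a(U)]; their images converge in the target. This uses neither
the square root of [1 - C^* C] nor a completion of [E]. *)

(** * Real norm and inner product *)

Section HilbertNorm.
Context {R : realType} {H : hilbertType R}.
Implicit Types x y : H.

Lemma ip_conjZ (a : R[i]) x y : ip (a *: x) y = ip x (Num.conj a *: y).
Proof. by rewrite /ip linearZl_LR linearZr_LR /= conjCK. Qed.

Lemma inner_extl x y : (forall h, inner x h = inner y h) -> x = y.
Proof. by move=> E; apply: inner_ext => h; rewrite hermC [RHS]hermC /= E. Qed.

Lemma rnormZ (a : R[i]) x : rnorm (a *: x) = complex.Re `|a| * rnorm x.
Proof.
have E : `|a| = (complex.Re `|a|)%:C by rewrite RRe_real// normr_real.
by rewrite {1}/rnorm normrZ E rnormE -rmorphM.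
Qed.

Lemma ler_rnormD x y : rnorm (x + y) <= rnorm x + rnorm y.
Proof. by rewrite -lecR rmorphD /= -!rnormE ler_normD. Qed.

Lemma opnorm_ge0 (A : bop H) : 0 <= opnorm A.
Proof.
apply: (le_trans (rnorm_ge0 (A 0))); apply: ub_le_sup.
  exact: (opnorm_has_sup A).2.
by exists 0; rewrite //= normr0 ler01.
Qed.

Lemma opnorm_le_bound (A : bop H) (M : R) :
  0 <= M -> (forall x, rnorm (A x) <= M * rnorm x) -> opnorm A <= M.
Proof.
move=> M0 AM; apply: ge_sup; first exact: (opnorm_has_sup A).1.
move=> _ [x /= + <-]; rewrite rnormE (lecR _ 1) => x1.
by rewrite (le_trans (AM x))// ler_piMr.
Qed.

End HilbertNorm.

(** * The adjoint of an inclusion and the associated projections *)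

Section Coisometry.
Context {R : realType} {H K : hilbertType R} (j : inclusion H K).

Lemma rnorm_incl h : rnorm (j h) = rnorm h.
Proof.
by apply/eqP; rewrite -(@eqrXn2 _ 2) ?rnorm_ge0// !rnorm_ip /ip incl_inner.
Qed.

Lemma coincl_exists :
  exists p : {linear K -> H}, forall h k, inner (j h) k = inner h (p k).
Proof.
have /choice[p jp] : forall k, exists z, forall h, inner (j h) k = inner h z.
  move=> k.
  have lf : linear_for *%R (fun h => inner (j h) k).
    by move=> a u v; rewrite linearP linearPl.
  pose F := GRing.isLinear.Build _ _ _ _ _ lf.
  pose f : {linear H -> R[i] | *%R} := HB.pack (fun h => inner (j h) k) F.
  apply: (@riesz _ _ f (rnorm k)) => h /=.
  by rewrite (le_trans (ip_le _ _))// rnorm_incl mulrC.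
have lp : linear p.
  move=> a u v; apply: inner_ext => h.
  by rewrite -jp !linearPr /= !jp.
pose F := GRing.isLinear.Build _ _ _ _ _ lp.
pose f : {linear K -> H} := HB.pack p F.
by exists f.
Qed.

(** This is the adjoint [j^*] of the inclusion; [j \o coincl] is the orthogonal
projection of [K] onto the image of [H]. *)
Definition coincl : {linear K -> H} := projT1 (cid coincl_exists).

Lemma inner_incll h k : inner (j h) k = inner h (coincl k).
Proof. exact: (projT2 (cid coincl_exists)). Qed.

Lemma inner_inclr h k : inner k (j h) = inner (coincl k) h.
Proof. by rewrite hermC /= inner_incll [RHS]hermC /=. Qed.

Lemma ip_coincl h k : ip (j h) k = ip h (coincl k).
Proof. by rewrite /ip inner_incll. Qed.

Lemma coinclK : cancel j coincl.
Proof. by move=> h; apply: inner_ext => g; rewrite -inner_incll incl_inner. Qed.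

(** The orthogonal projection of [K] onto the orthogonal complement of [H]. *)
Definition coproj k : K := k - j (coincl k).

Lemma coproj_is_linear : linear coproj.
Proof.
by move=> a u v; rewrite /coproj !linearP /= scalerBr scalerN addrACA. Qed.
HB.instance Definition _ :=
  GRing.isLinear.Build _ _ _ _ coproj coproj_is_linear.

Lemma coincl_coproj k : coincl (coproj k) = 0.
Proof. by rewrite /coproj linearB /= coinclK subrr. Qed.

Lemma rnorm_incl_coproj h k :
  rnorm (j h + coproj k) ^+ 2 = rnorm h ^+ 2 + rnorm (coproj k) ^+ 2.
Proof.
rewrite rnormD2 rnorm_incl ip_coincl coincl_coproj.
by rewrite /ip linear0r /= mulr0 addr0.
Qed.

Lemma incl_coprojK k : j (coincl k) + coproj k = k.
Proof. by rewrite addrC subrK. Qed.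

Lemma rnorm_coincl k : rnorm (coincl k) <= rnorm k.
Proof.
rewrite -(@ler_pXn2r _ 2) ?nnegrE ?rnorm_ge0// -[in leRHS](incl_coprojK k).
by rewrite rnorm_incl_coproj lerDl sqr_ge0.
Qed.

Lemma rnorm_coproj k : rnorm (coproj k) <= rnorm k.
Proof.
rewrite -(@ler_pXn2r _ 2) ?nnegrE ?rnorm_ge0// -[in leRHS](incl_coprojK k).
by rewrite rnorm_incl_coproj lerDr sqr_ge0.
Qed.

(** Taking adjoints in the definition of a lift removes every adjoint of an
operator, so that lifts can be built without computing [adj]. *)
Lemma is_liftP (A : bop H) (B : bop K) :
  is_lift j A B <-> forall k, coincl (B k) = A (coincl k).
Proof.
split=> [AB k|AB h].
  by apply: inner_extl => x; rewrite -inner_inclr adjP AB inner_inclr adjP.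
apply: inner_ext => x; by rewrite -adjP !inner_inclr AB adjP.
Qed.

End Coisometry.

(** * Extending a map dominated by the defect of a contraction *)

Section ColumnCompletion.
Context {R : realType} {E F : hilbertType R} (C : {linear E -> F}).
Hypothesis C1 : forall x, rnorm (C x) <= rnorm x.
Implicit Types (x y : E) (c : R[i]).

(** The real part of [<(1 - C^* C) x, y>]. Real parts suffice because the bounds
below are always required of all elements of a complex subspace. *)
Definition dform x y : R := ip x y - ip (C x) (C y).

Definition dnorm x : R := Num.sqrt (dform x x).

Lemma dformC x y : dform x y = dform y x.
Proof. by rewrite /dform ipC (ipC (C x)). Qed.

Lemma dformDl x y z : dform (x + y) z = dform x z + dform y z.
Proof. by rewrite /dform linearD !ipDl opprD addrACA. Qed.

Lemma dformDr x y z : dform z (x + y) = dform z x + dform z y.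
Proof. by rewrite !(dformC z) dformDl. Qed.

Lemma dformNl x y : dform (- x) y = - dform x y.
Proof. by rewrite /dform linearN !ipNl opprD. Qed.

Lemma dformNr x y : dform y (- x) = - dform y x.
Proof. by rewrite !(dformC y) dformNl. Qed.

Lemma dformZl c x y : dform (c *: x) y = dform x (Num.conj c *: y).
Proof. by rewrite /dform !linearZ !ip_conjZ. Qed.

Lemma dform_realZl (t : R) x y : dform (t%:C *: x) y = t * dform x y.
Proof. by rewrite /dform linearZ !ipZl mulrBr. Qed.

Lemma dformE x : dform x x = rnorm x ^+ 2 - rnorm (C x) ^+ 2.
Proof. by rewrite !rnorm_ip. Qed.

Lemma dform_ge0 x : 0 <= dform x x.
Proof. by rewrite dformE subr_ge0 ler_pXn2r ?nnegrE ?rnorm_ge0. Qed.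

Lemma dnorm_ge0 x : 0 <= dnorm x. Proof. exact: sqrtr_ge0. Qed.

Lemma sqr_dnorm x : dnorm x ^+ 2 = dform x x.
Proof. exact/sqr_sqrtr/dform_ge0. Qed.

Lemma dnorm0 : dnorm 0 = 0.
Proof. by rewrite /dnorm dformE linear0 /rnorm !normr0 subrr sqrtr0. Qed.

Lemma dnormN x : dnorm (- x) = dnorm x.
Proof. by rewrite /dnorm dformNl dformNr opprK. Qed.

Lemma dnormZ c x : dnorm (c *: x) = complex.Re `|c| * dnorm x.
Proof.
have c0 : 0 <= complex.Re `|c| by rewrite -ler0c RRe_real ?normr_real.
apply/eqP; rewrite -(@eqrXn2 _ 2) ?mulr_ge0 ?dnorm_ge0//.
rewrite exprMn !sqr_dnorm !dformE (linearZ_LR C) !rnormZ.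
by apply/eqP; ring.
Qed.

Context {G : hilbertType R} {U : lmodType R[i]}.
Context (a : {linear U -> E}) (b : {linear U -> G}).
Hypothesis ab :
  forall u, rnorm (C (a u)) ^+ 2 + rnorm (b u) ^+ 2 <= rnorm (a u) ^+ 2.

Lemma rnorm_le_dnorm u : rnorm (b u) <= dnorm (a u).
Proof.
rewrite -(@ler_pXn2r _ 2) ?nnegrE ?rnorm_ge0 ?dnorm_ge0// sqr_dnorm dformE.
by rewrite lerBrDl.
Qed.

(** Approximate orthogonality, in the defect seminorm, of [x - a u] to the
subspace [a(U)]. Unlike near-minimality of the distance, this condition is
visibly linear in the pair [(x, u)], and so are the values derived from it. *)
Definition near_proj (e : R) x u :=
  forall v, dform (x - a u) (a v) <= e * dnorm (a v).

Lemma near_projD e e' x x' u u' :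
  near_proj e x u -> near_proj e' x' u' ->
  near_proj (e + e') (x + x') (u + u').
Proof.
move=> xu xu' v.
by rewrite linearD opprD addrACA dformDl mulrDl lerD.
Qed.

Lemma near_projZ e c x u :
  near_proj e x u -> near_proj (complex.Re `|c| * e) (c *: x) (c *: u).
Proof.
move=> xu v; rewrite (linearZ_LR a) -scalerBr dformZl -(linearZ_LR a).
rewrite (le_trans (xu _))//.
by rewrite (linearZ_LR a) dnormZ norm_conjC mulrCA mulrA.
Qed.

Lemma near_proj_le e e' x u : e <= e' -> near_proj e x u -> near_proj e' x u.
Proof.
by move=> ee xu v; rewrite (le_trans (xu v))// ler_wpM2r ?dnorm_ge0.
Qed.

Lemma near_proj_refl e u : 0 <= e -> near_proj e (a u) u.
Proof.
move=> e0 v; rewrite subrr -(scale0r 0) dform_realZl mul0r.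
by rewrite mulr_ge0 ?dnorm_ge0.
Qed.

(** An exact projection does not increase the seminorm; testing near
orthogonality on [- a u] gives, with [N] for the seminorm,
[N x ^ 2 >= N (a u) ^ 2 - 2 e N (a u)], whence the error [2 e]. For [x = 0] this also
says that two approximate projections of one point are close to each other. *)
Lemma near_proj_dnorm e x u :
  0 <= e -> near_proj e x u -> dnorm (a u) <= dnorm x + 2 * e.
Proof.
move=> e0 xu; have := xu (- u).
rewrite linearN dformNr dnormN => ou.
have E2 : dnorm x ^+ 2 = dnorm (x - a u) ^+ 2 + dnorm (a u) ^+ 2
    + 2 * dform (x - a u) (a u).
  rewrite !sqr_dnorm -{1 2}(subrK (a u) x) !(dformDl, dformDr).
  rewrite !(dformC (a u)); ring.
have := sqr_ge0 (dnorm (x - a u)); have := dnorm_ge0 x.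
have := dnorm_ge0 (a u); move: ou E2.
move: (dform _ _) (dnorm _) (dnorm (a u)) (dnorm x) => f d n m ou E2 n0 m0 d0.
rewrite leNgt; apply/negP => mn.
nra.
Qed.

(** A point [a u] whose squared distance to [x] is within [e ^+ 2] of the infimum
works: moving it by [t a v] cannot gain more than [e ^+ 2], which bounds a
quadratic polynomial in [t] from below and hence its linear coefficient. *)
Lemma near_proj_exists e x : 0 < e -> exists u, near_proj e x u.
Proof.
move=> e0; pose J u := dform (x - a u) (x - a u).
have Jinf : has_inf (range J).
  by split; [exists (J 0), 0 | exists 0 => _ [u _ <-]; exact: dform_ge0].
have [_ [u _ <-] Ju] := inf_adherent (exprn_gt0 2 e0) Jinf.
exists u => v.
have step (t : R) : 2 * t * dform (x - a u) (a v) <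
    t ^+ 2 * dnorm (a v) ^+ 2 + e ^+ 2.
  have : inf (range J) <= J (u + t%:C *: v).
    by apply: ge_inf; [exact: Jinf.2 | exists (u + t%:C *: v)].
  have -> : J (u + t%:C *: v) = J u - 2 * t * dform (x - a u) (a v)
      + t ^+ 2 * dnorm (a v) ^+ 2.
    rewrite /J linearD (linearZ_LR a) opprD addrA.
    rewrite sqr_dnorm !(dformDl, dformNl, dform_realZl, dformDr, dformNr).
    rewrite !(dformC _ (t%:C *: _)) !dform_realZl !(dformC (a v)); ring.
  by move: Ju; lra.
have := dnorm_ge0 (a v); rewrite le_eqVlt => /predU1P[n0|n0].
  (* If [a v] has seminorm zero the polynomial is affine in [t], and a large [t]
     excludes a positive slope. *)
  rewrite -n0 mulr0 leNgt; apply/negP => f0.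
  have := step (e ^+ 2 / dform (x - a u) (a v)).
  rewrite -n0 expr0n mulr0 add0r -mulrA divfK ?lt0r_neq0//.
  by have := exprn_gt0 2 e0; lra.
(* Otherwise [t = e / dnorm (a v)] balances the two other terms. *)
have [q q0 eE] : exists2 q, 0 < q & e = q * dnorm (a v).
  by exists (e / dnorm (a v)); rewrite ?divr_gt0// divfK ?lt0r_neq0.
have := step q; rewrite eE -(ler_pM2l q0).
by move: (dnorm _) (dform _ _) => n f; lra.
Qed.

(** [z] is a limit of [b u] along approximate projections [a u] of [x]: the value
at [x] of the extension, described without choosing a sequence. *)
Definition ext_value x (z : G) :=
  forall e, 0 < e -> exists2 u, near_proj e x u & rnorm (z - b u) < e.

(** The approximate projections of [x] form a Cauchy family for the seminorm,
which [b] maps to a Cauchy family of the complete space [G]. *)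
Lemma ext_value_exists x : exists z, ext_value x z.
Proof.
have [z zP] : exists z, forall e, 0 < e ->
    exists2 y, [set b u | u in near_proj e x] y & rnorm (z - y) < e.
  apply: (@cauchy_family _ _ (fun e => [set b u | u in near_proj e x])).
  - by move=> e e' ee _ [u xu <-]; exists u => //; exact: near_proj_le xu.
  - by move=> e /(near_proj_exists x)[u xu]; exists (b u), u.
  - move=> e e0; exists (e / 8); first by rewrite divr_gt0.
    move=> _ _ [u xu <-] [v xv <-].
    rewrite -linearB (le_lt_trans (rnorm_le_dnorm _))//.
    have := near_projD xu (near_projZ (-1) xv).
    rewrite !scaleN1r subrr normrN1 mul1r => /near_proj_dnorm.
    by rewrite dnorm0 => /(_ _)/le_lt_trans; apply; lra.
exists z => e /zP[_ [u xu <-]]; by exists u.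
Qed.

Lemma ext_value_dnorm x z : ext_value x z -> rnorm z <= dnorm x.
Proof.
move=> xz; apply/ler_addgt0Pr => e e0.
have e3 : 0 < e / 3 by rewrite divr_gt0.
have [u xu zu] := xz _ e3.
have := near_proj_dnorm (ltW e3) xu; have := rnorm_le_dnorm u.
have := ler_rnormD (z - b u) (b u); rewrite subrK.
by move: zu; lra.
Qed.

Lemma ext_value_linear c x x' z z' :
  ext_value x z -> ext_value x' z' -> ext_value (c *: x + x') (c *: z + z').
Proof.
move=> xz xz' e e0; set k := complex.Re `|c|.
have k0 : 0 <= k by rewrite -ler0c RRe_real ?normr_real.
have d0 : 0 < e / (k + 1) by rewrite divr_gt0// ltr_wpDl.
have dE : k * (e / (k + 1)) + e / (k + 1) = e.
  by rewrite -[X in _ + X]mul1r -mulrDl mulrC divfK// lt0r_neq0// ltr_wpDl.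
have [u xu zu] := xz _ d0; have [u' xu' zu'] := xz' _ d0.
exists (c *: u + u').
  by have := near_projD (near_projZ c xu) xu'; rewrite -/k dE.
rewrite linearP opprD addrACA -scalerBr (le_lt_trans (ler_rnormD _ _))//.
by rewrite rnormZ -/k -[ltRHS]dE ler_ltD// ler_wpM2l// ltW.
Qed.

(** By linearity two values differ by a value at [0], where the seminorm is [0]. *)
Lemma ext_value_unique x z z' : ext_value x z -> ext_value x z' -> z = z'.
Proof.
move=> xz xz'; have := ext_value_dnorm (ext_value_linear (-1) xz' xz).
rewrite !scaleN1r addNr dnorm0 => d0; apply/eqP.
by rewrite -subr_eq0 addrC -rnorm_eq0 eq_le d0 rnorm_ge0.
Qed.

(** The column with entries [C] and [Q] is a contraction exactly when [Q] is
dominated by [dnorm]; taking limits along approximate projections preserves this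
bound and makes [Q] linear. *)
Lemma column_completion : exists2 Q : {linear E -> G},
  forall u, Q (a u) = b u &
  forall x, rnorm (C x) ^+ 2 + rnorm (Q x) ^+ 2 <= rnorm x ^+ 2.
Proof.
have /choice[Q xQ] := ext_value_exists.
have lQ : linear Q.
  move=> c x y; exact: ext_value_unique (xQ _) (ext_value_linear _ (xQ x) (xQ y)).
pose L := GRing.isLinear.Build _ _ _ _ _ lQ.
pose f : {linear E -> G} := HB.pack Q L.
exists f => [u|x].
  apply: ext_value_unique (xQ _) _ => e e0; exists u.
    exact: near_proj_refl (ltW e0).
  by rewrite subrr /rnorm normr0.
have := ext_value_dnorm (xQ x).
rewrite -(@ler_pXn2r _ 2) ?nnegrE ?rnorm_ge0 ?dnorm_ge0// sqr_dnorm dformE.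
by rewrite lerBrDl.
Qed.

End ColumnCompletion.

(** * Parrott's theorem and the lifting *)

(** The prescription on [a(U)] splits into its component along [H], which is that
of [C] by compatibility, and its component along the complement, which is
extended by [column_completion]. The subspace is the range of a map [a] so that
no domain of definition appears; [b] is well defined on it by the second
hypothesis. *)
Theorem parrott (R : realType) (E H K : hilbertType R) (U : lmodType R[i])
    (j : inclusion H K) (a : {linear U -> E}) (b : {linear U -> K})
    (C : {linear E -> H}) :
    (forall x, rnorm (C x) <= rnorm x) ->
    (forall u, rnorm (b u) <= rnorm (a u)) ->
    (forall u, coincl j (b u) = C (a u)) ->
  exists S : {linear E -> K}, [/\ forall x, rnorm (S x) <= rnorm x,
    forall u, S (a u) = b u & forall x, coincl j (S x) = C x].
Proof.
move=> C1 ba bC.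
have ab u : rnorm (C (a u)) ^+ 2 + rnorm ((coproj j \o b) u) ^+ 2
    <= rnorm (a u) ^+ 2.
  rewrite -bC /= -rnorm_incl_coproj incl_coprojK.
  by rewrite ler_pXn2r ?nnegrE ?rnorm_ge0.
have [Q Qa CQ] := column_completion C1 ab.
pose S : {linear E -> K} := (j \o C) \+ (coproj j \o Q).
exists S; split=> [x|u|x] /=.
- rewrite -(@ler_pXn2r _ 2) ?nnegrE ?rnorm_ge0// rnorm_incl_coproj.
  rewrite (le_trans _ (CQ x))// lerD2l ler_pXn2r ?nnegrE ?rnorm_ge0//.
  exact: rnorm_coproj.
- rewrite Qa /= -[in RHS](incl_coprojK j (b u)) bC; congr (_ + _).
  by rewrite {1}/coproj coincl_coproj linear0 subr0.
- by rewrite linearD /= coinclK coincl_coproj addr0.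
Qed.

(** Extending [A] by zero on the complement of [H] gives the simplest lift of [A]
that has the same norm. *)
Lemma incl_coincl_bop (R : realType) (H K : hilbertType R) (j : inclusion H K)
    (A : bop H) :
  exists B : bop K, forall k, B k = j (A (coincl j k)).
Proof.
pose f : {linear K -> K} := j \o (A \o coincl j).
have fb k : rnorm (f k) <= opnorm A * rnorm k.
  rewrite /= rnorm_incl (le_trans (opnorm_le _ _))// ler_wpM2l ?rnorm_coincl//.
  exact: opnorm_ge0.
by exists (Bop (bop_intro fb)).
Qed.

Theorem theorem7p3 (R : realType) (H : hilbertType R) (X T1 T2 : bop H)
    (hX : contractive X) (hT1 : contractive T1) (hT2 : contractive T2)
    (hTX : forall h : H, T1 (X h) = X (T2 h))
    (K : hilbertType R) (j : inclusion H K) (V : bop K)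
    (hV : isometric_lift j X V) :
  exists S1 S2 : bop K,
    contractive_lift j T1 S1 /\ norm_preserving_lift j T2 S2 /\
    (forall k : K, S1 (V k) = V (S2 k)).
Proof.
have contr (A : bop H) h : contractive A -> rnorm (A h) <= rnorm h.
  by move=> A1; rewrite (le_trans (opnorm_le A h))// ler_piMl ?rnorm_ge0.
have [VX Viso] := hV; move/is_liftP: VX => VX.
have [S2 S2E] := incl_coincl_bop j T2.
have Vn k : rnorm (V k) = rnorm k by rewrite /rnorm Viso.
have jT1 k : rnorm ((T1 \o coincl j) k) <= rnorm k.
  by rewrite (le_trans (contr _ _ hT1))// rnorm_coincl.
have VS2 k : rnorm ((V \o S2) k) <= rnorm (V k).
  rewrite /= !Vn S2E rnorm_incl (le_trans (contr _ _ hT2))//.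
  exact: rnorm_coincl.
have comp k : coincl j ((V \o S2) k) = (T1 \o coincl j) (V k).
  by rewrite /= !VX S2E coinclK hTX.
have [S [S1 SV jS]] := parrott jT1 VS2 comp.
have Sb k : rnorm (S k) <= 1 * rnorm k by rewrite mul1r.
exists (Bop (bop_intro Sb)), S2; split; [split|split; [split|]] => //.
- exact/is_liftP.
- exact: opnorm_le_bound.
- by apply/is_liftP => k; rewrite S2E coinclK.
- apply/eqP; rewrite eq_le; apply/andP; split; apply: opnorm_le_bound;
    rewrite ?opnorm_ge0// => x.
    rewrite S2E rnorm_incl (le_trans (opnorm_le _ _))//.
    by rewrite ler_wpM2l ?opnorm_ge0 ?rnorm_coincl.
  have <- : rnorm (S2 (j x)) = rnorm (T2 x) by rewrite S2E coinclK rnorm_incl.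
  by rewrite (le_trans (opnorm_le _ _))// rnorm_incl.
Qed.
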